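(* Let $a=(a_i)_{i\in\mathbb Z}$ be a sequence of pairwise distinct complex numbers and $\mu$ a Young diagram. An element $F\in\Lambda$ equals $s_{\mu;a}$ if and only if (i) $F(x(\lambda);y(\lambda))=0$ for all Young diagrams $\lambda\ne\mu$ with $|\lambda|\le|\mu|$, and (ii) $F$ has degree $\le|\mu|$ and $F(x(\mu);y(\mu))=\prod_{(i,j)\in\mu}(a_{\mu_i-i+1}-a_{j-\mu'_j})$. Also, $F$ equals $s_{\mu;a}$ if and only if (i$'$) $F(x(\lambda);y(\lambda))=0$ for all Young diagrams $\lambda$ with $|\lambda|<|\mu|$, and (ii$'$) the top-degree homogeneous component of $F$ is the Schur function $s_\mu$.
   Context: $\Lambda$ is the algebra of symmetric functions over $\mathbb C$ with complete homogeneous $h_k$, elementary $e_k$, power sums $\mathbf p_k$, Schur functions $s_\mu$. For a sequence $a$ define $h_{k;a}=\sum_{i=1}^k(-1)^{k-i}e_{k-i}(a_1,\dots,a_{k-1})h_i$ ($k\ge1$), $h_{0;a}=1$, $h_{k;a}=0$ ($k<0$); $(\tau^ra)_i=a_{i+r}$; $s_{\mu;a}=\det[h_{\mu_i-i+j;\,\tau^{1-j}a}]_{i,j=1}^N$ for any $N\ge\ell(\mu)$. Dual sequence: $\widehat a_i=-a_{1-i}$. $\mu'$ is the transposed diagram; boxes $(i,j)$ are indexed by row $i$ and column $j$. Each $f\in\Lambda$ is evaluated at $(x;y)\in\mathbb C^d\times\mathbb C^d$ via $\mathbf p_k\mapsto\sum_ix_i^k+(-1)^{k-1}\sum_jy_j^k$.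 For a nonempty diagram $\lambda=(p_1,\dots,p_d\mid q_1,\dots,q_d)$ in Frobenius notation ($p_i=\lambda_i-i$, $q_i=\lambda'_i-i$, $d$ the number of diagonal boxes), $(x(\lambda);y(\lambda))=(a_{p_1+1},\dots,a_{p_d+1};\widehat a_{q_1+1},\dots,\widehat a_{q_d+1})$; and $(x(\varnothing);y(\varnothing))=(0;0)$. *)

(* Defs.v *)
(* complex numbers C := R[i] with R the Stdlib reals (via Rstruct),
   symmetric functions represented in power-sum coordinates via multinomials' mpoly. *)
From mathcomp Require Import all_boot all_algebra.
From mathcomp Require Import reals Rstruct complex.
From mathcomp Require Import mpoly.
Set Implicit Arguments. Unset Strict Implicit. Unset Printing Implicit Defensive.
Import GRing.Theory.
Local Open Scope ring_scope.

Definition C : closedFieldType := (Rdefinitions.R)[i].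

Definition is_partition (l : seq nat) : bool :=
  sorted geq l && all (fun k => (0 < k)%N) l.

(* l_i for i >= 1 (and 0 beyond the length) *)
Definition part (l : seq nat) (i : nat) : nat := nth 0%N l i.-1.
Definition conjp (l : seq nat) (j : nat) : nat := count (fun k => (j <= k)%N) l.
Definition ndiag (l : seq nat) : nat := count (fun i => (i <= part l i)%N) (iota 1 (size l)).

Definition dualseq (a : int -> C) : int -> C := fun i => - a (1 - i).
Definition tau (r : int) (a : int -> C) : int -> C := fun i => a (i + r).

Definition xcoord (a : int -> C) (l : seq nat) : seq C :=
  [seq a ((part l i - i)%N.+1 : int) | i <- iota 1 (ndiag l)].
Definition ycoord (a : int -> C) (l : seq nat) : seq C :=
  [seq dualseq a ((conjp l i - i)%N.+1 : int) | i <- iota 1 (ndiag l)].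

Definition esym_at (m : nat) (s : seq C) : C :=
  \sum_(I : {set 'I_(size s)} | #|I| == m) \prod_(i in I) s`_i.

(* ---------- Lambda in power-sum coordinates: p_k = 'X_(k-1), k = 1..n ---------- *)
Section Lambda.
Variable n : nat.
Local Notation P := {mpoly C[n]}.

(* the power sum p_k (k >= 1); only used for k <= n *)
Definition psum (k : nat) : P :=
  if k is k'.+1 then
    (if @insub nat (fun j => (j < n)%N) 'I_n k' is Some i then 'X_i else 0)
  else 0.

(* [h_k; h_{k-1}; ...; h_0] via Newton's identities k h_k = sum_{i=1}^k p_i h_{k-i} *)
Fixpoint hrev (k : nat) : seq P :=
  match k with
  | 0 => [:: 1]
  | k'.+1 => let s := hrev k' in
             ((k'.+1)%:R^-1 *: \sum_(i < k'.+1) psum i.+1 * nth 0 s i) :: s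
  end.

Definition hcomp (k : nat) : P := head 0 (hrev k).
Definition hZ (k : int) : P := match k with Posz m => hcomp m | Negz _ => 0 end.

Definition hsh (a : int -> C) (k : int) : P :=
  match k with
  | Posz 0 => 1
  | Posz k'.+1 =>
      \sum_(i < k'.+1)
        ((-1) ^+ (k' - i) * esym_at (k' - i) [seq a (j%:Z) | j <- iota 1 k'])
          *: hcomp i.+1
  | Negz _ => 0
  end.

Definition schur_a (a : int -> C) (mu : seq nat) : P :=
  \det (\matrix_(i < size mu, j < size mu)
          hsh (tau (1 - (j.+1)%:Z) a) ((part mu i.+1)%:Z - (i.+1)%:Z + (j.+1)%:Z)).

(* Schur function s_mu (Jacobi-Trudi) *)
Definition schur (mu : seq nat) : P :=
  \det (\matrix_(i < size mu, j < size mu)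
          hZ ((part mu i.+1)%:Z - (i.+1)%:Z + (j.+1)%:Z)).

(* grading: deg p_k = k *)
Definition wdeg (m : 'X_{1..n}) : nat := \sum_(i < n) (i.+1 * m i)%N.
Definition deg_le (F : P) (d : nat) : Prop := forall m, m \in msupp F -> (wdeg m <= d)%N.
Definition topdeg (F : P) : nat := \max_(m <- msupp F) wdeg m.
Definition topcomp (F : P) : P :=
  \sum_(m <- msupp F | wdeg m == topdeg F) F@_m *: 'X_[m].

Definition pval (x y : seq C) (k : nat) : C :=
  \sum_(u <- x) u ^+ k + (-1) ^+ k.-1 * \sum_(v <- y) v ^+ k.
Definition evalxy (F : P) (x y : seq C) : C := F.@[fun i : 'I_n => pval x y i.+1].
Definition evalat (a : int -> C) (F : P) (l : seq nat) : C :=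
  evalxy F (xcoord a l) (ycoord a l).
End Lambda.

Definition hookprod (a : int -> C) (mu : seq nat) : C :=
  \prod_(i < size mu) \prod_(j < part mu i.+1)
     (a ((part mu i.+1)%:Z - (i.+1)%:Z + 1) - a ((j.+1)%:Z - (conjp mu j.+1)%:Z)).

(* Main.v *)
Require Import Defs.
From mathcomp Require Import all_boot all_algebra.
From mathcomp Require Import reals Rstruct complex.
From mathcomp Require Import mpoly.
From mathcomp Require Import order fingroup perm zify ring.
Import Order.TTheory GRing.Theory Num.Theory.
Local Open Scope ring_scope.
Set Implicit Arguments. Unset Strict Implicit. Unset Printing Implicit Defensive.

(* Evaluated at a diagram lambda, the generating series of the h_k is the
   rational function prod_(i <= N) (u - a_(1-i)) / (u - x_i) with
   x_i = a_(lambda_i - i + 1), because the Frobenius coordinates are the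
   particles and holes of the Maya diagram of lambda.  Each entry of the
   Jacobi-Trudi matrix becomes the residue at infinity of
   A_i(u) B_j(u) / prod_k (u - x_k), with A_i, B_j products of factors u - a_m,
   so expanding over the simple poles x_k gives
     s_(mu;a)(lambda) = det [A_i(x_k)] / prod_(k < l) (x_k - x_l).
   As A_i(x_k) <> 0 iff lambda_k - k >= mu_i - i, this vanishes whenever
   |lambda| <= |mu| and lambda <> mu, and it is triangular at lambda = mu.
   There are as many monomials of degree <= d in the power sums as diagrams of
   size <= d, so the triangular matrix of values s_(mu;a)(lambda) being
   invertible forces an element of degree <= d vanishing at all |lambda| <= d
   to be 0; uniqueness in both characterizations follows, together with
   s_mu <> 0. *)

(** * Newton's identities for formal power series *)

Section Newton.
Variable K : fieldType.
Implicit Types (p H : nat -> K) (z : K) (zs : seq K).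

(* A sequence H stands for the series H(t) = sum_k H_k t^k: [mul1sub z] is
   multiplication by 1 - z t and [newton_defect p] is t d/dt - sum_(i > 0) p_i t^i. *)
Definition mul1sub z H (k : nat) : K :=
  if k is k'.+1 then H k'.+1 - z * H k' else H 0%N.

Definition newton_defect p H (k : nat) : K :=
  k%:R * H k - \sum_(i < k) p i.+1 * H (k.-1 - i)%N.

Lemma eq_newton_defect p p' H H' : (forall k, p k.+1 = p' k.+1) -> H =1 H' ->
  newton_defect p H =1 newton_defect p' H'.
Proof.
move=> ep eH k; rewrite /newton_defect eH; congr (_ - _).
by apply: eq_bigr => i _; rewrite ep eH.
Qed.

(** Coefficient of [t^(k+1)] in [z t / (1 - z t) * ((1 - z t) H) = z t H]. *)
Lemma sum_expr_mul1sub z H k :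
  \sum_(i < k.+1) z ^+ i.+1 * mul1sub z H (k - i)%N = z * H k.
Proof.
elim: k => [|k IHk]; first by rewrite big_ord1 /=.
rewrite big_ord_recl /=.
have -> : \sum_(i < k.+1) z ^+ (bump 0 i).+1 * mul1sub z H (k.+1 - bump 0 i)%N
   = z * (z * H k).
  rewrite -IHk mulr_sumr; apply: eq_bigr => i _.
  by rewrite /bump /= add1n subSS exprS mulrA.
by rewrite expr1; ring.
Qed.

(** Since [t d/dt] sends [1 - z t] to [- z t], which is [- (1 - z t)] times [sum_(i > 0) z^i t^i],
    removing [z^i] from [p_i] compensates exactly for the new factor. *)
Lemma newton_defect_mul1sub p z H :
  newton_defect (fun i => p i - z ^+ i) (mul1sub z H) =1
  mul1sub z (newton_defect p H).
Proof.
case=> [|k]; first by rewrite /newton_defect /= !big_ord0 !mul0r.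
rewrite /newton_defect.
under eq_bigr do rewrite mulrBl.
rewrite sumrB /= sum_expr_mul1sub.
(* The last summand involves [H 0], which [mul1sub] leaves unchanged, so the correction sum is one
   term shorter. *)
rewrite (_ : \sum_(i < k.+1) p i.+1 * mul1sub z H (k - i)%N =
   \sum_(i < k.+1) p i.+1 * H (k - i)%N
   - z * \sum_(i < k) p i.+1 * H (k.-1 - i)%N); last first.
  rewrite !big_ord_recr /= subnn /= mulr_sumr addrAC -sumrB; congr (_ + _).
  apply: eq_bigr => i _; have := ltn_ord i.
  case: k i => [|k] i; first by case: i.
  by rewrite ltnS => ik; rewrite subSn //=; ring.
rewrite -[k.+1%:R]/(1 *+ k.+1) mulrS -/(k%:R); ring.
Qed.

Lemma newton_defect_foldr p zs H :
  newton_defect (fun i => p i - \sum_(z <- zs) z ^+ i) (foldr mul1sub H zs) =1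
  foldr mul1sub (newton_defect p H) zs.
Proof.
elim: zs p => [|z zs IH] p k /=.
  by apply: eq_newton_defect => // i; rewrite big_nil subr0.
rewrite (@eq_newton_defect _ (fun i => (p i - \sum_(z <- zs) z ^+ i) - z ^+ i) _
  (mul1sub z (foldr mul1sub H zs))) //; last first.
  by move=> i; rewrite big_cons opprD addrA addrAC.
rewrite newton_defect_mul1sub; case: k => [|k]; by rewrite /= !IH.
Qed.

(** A product of factors [1 - z t] has constant term 1, so it is not a zero divisor. *)
Lemma foldr_mul1sub_eq0 zs H :
  foldr mul1sub H zs =1 (fun=> 0) <-> H =1 (fun=> 0).
Proof.
elim: zs => // z zs <- /=; split=> h k; last by case: k => [|k] /=; rewrite !h ?mulr0 ?subr0.
elim: k => [|k IHk]; first exact: (h 0%N).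
by have /= := h k.+1; rewrite IHk mulr0 subr0.
Qed.

(** Newton's recurrence expresses [k H_k] by earlier entries, and a positive [k] is invertible. *)
Lemma eq_newton p H H' n : (forall k, k.+1%:R != 0 :> K) -> H 0%N = H' 0%N ->
  (forall k, (k <= n)%N -> newton_defect p H k = newton_defect p H' k) ->
  forall k, (k <= n)%N -> H k = H' k.
Proof.
move=> ch0 e0 e k; elim/ltn_ind: k => -[|k] IH kn //.
have /eqP := e _ kn; rewrite /newton_defect /=.
rewrite (eq_bigr (fun i : 'I_k.+1 => p i.+1 * H' (k - i)%N)); last first.
  by move=> i _; rewrite IH //; lia.
rewrite (inj_eq (addIr _)) => /eqP /mulfI; apply.
exact: ch0.
Qed.

End Newton.
Arguments mul1sub {K} z H k.

(** * Divided differences and expansions in [t = 1/u] *)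

Section DividedDifference.
Variables (K : fieldType) (N : nat) (x : 'I_N.+1 -> K).
Hypothesis x_inj : injective x.
Implicit Types f g : {poly K}.

(* The residue at infinity of f(u) / prod_k (u - x_k). *)
Definition ddiff f : K :=
  \sum_k f.[x k] / \prod_(l | l != k) (x k - x l).

Lemma ddiffB f g : ddiff (f - g) = ddiff f - ddiff g.
Proof. by rewrite /ddiff -sumrB; apply: eq_bigr => k _; rewrite hornerD hornerN mulrBl. Qed.

Lemma ddiffZ c f : ddiff (c *: f) = c * ddiff f.
Proof. by rewrite /ddiff mulr_sumr; apply: eq_bigr => k _; rewrite hornerZ mulrA. Qed.

Lemma ddiff_sum (I : Type) (r : seq I) (P : pred I) (F : I -> {poly K}) :
  ddiff (\sum_(i <- r | P i) F i) = \sum_(i <- r | P i) ddiff (F i).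
Proof.
rewrite /ddiff exchange_big; apply: eq_bigr => k _ /=.
by rewrite horner_sum mulr_suml.
Qed.

Lemma ddiff_root f : (forall k, f.[x k] = 0) -> ddiff f = 0.
Proof. by move=> f0; rewrite /ddiff big1 // => k _; rewrite f0 mul0r. Qed.

Lemma ddiff_prod_neq0 k : \prod_(l | l != k) (x k - x l) != 0.
Proof.
apply/prodf_neq0 => l lk; rewrite subr_eq0.
by apply: contraNneq lk => /x_inj ->.
Qed.

(* Compare the coefficients of [u^N] in Lagrange's interpolation formula. *)
Lemma ddiff_coef f : (size f <= N.+1)%N -> ddiff f = f`_N.
Proof.
move=> sf; pose L k : {poly K} := \prod_(l | l != k) ('X - (x l)%:P).
have cardN k : #|[pred l : 'I_N.+1 | l != k]| = N.
  by have := cardC1 k; rewrite card_ord.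
have sL k : size (L k) = N.+1.
  rewrite /L -big_filter size_prod_XsubC.
  by rewrite -[size _]/(size (filter _ _)) size_filter -sum1_count sum1_card cardN.
have mL k : (L k)`_N = 1.
  have : L k \is monic by rewrite /L monic_prod_XsubC.
  by move/monicP; rewrite /lead_coef sL.
pose g := \sum_k (f.[x k] / \prod_(l | l != k) (x k - x l)) *: L k.
have fg : f = g.
  apply/eqP; rewrite -subr_eq0; apply/eqP.
  apply: (@roots_geq_poly_eq0 _ _ [seq x k | k <- enum 'I_N.+1]).
  - apply/allP => _ /mapP[k _ ->]; apply/rootP.
    rewrite hornerD hornerN horner_sum (bigD1 k) //= [X in _ - (_ + X)]big1; last first.
      move=> i ik; rewrite hornerZ (_ : (L i).[x k] = 0) ?mulr0 //.
      rewrite horner_prod (bigD1 k) 1?eq_sym //=.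
      by rewrite hornerXsubC subrr mul0r.
    rewrite addr0 hornerZ (_ : (L k).[x k] = \prod_(l | l != k) (x k - x l)).
      by rewrite divfK ?subrr // ddiff_prod_neq0.
    by rewrite horner_prod; apply: eq_bigr => l _; rewrite hornerXsubC.
  - by rewrite map_inj_uniq // enum_uniq.
  - rewrite size_map size_enum_ord.
    apply: leq_trans (size_polyD _ _) _; rewrite geq_max sf size_polyN.
    apply: leq_trans (size_sum _ _ _) _; apply/bigmax_leqP => k _.
    by apply: leq_trans (size_scale_leq _ _) _; rewrite sL.
rewrite [in RHS]fg coef_sum; apply: eq_bigr => k _.
by rewrite coefZ mL mulr1.
Qed.

(* For f monic of degree N + 1, the coefficients of f(u) / prod_k (u - x_k) in 1/u. *)
Definition ddiff_seq f (k : nat) : K :=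
  if k is k'.+1 then ddiff ('X^k' * f) else 1.

(** The factor [1 - z t] turns [u f] into [(u - z) f]. At index 1 this needs [ddiff f = 1], the
    leading coefficient of [f]. *)
Lemma mul1sub_ddiff_seq z f : f \is monic -> size f = N.+1 ->
  mul1sub z (ddiff_seq ('X * f)) =1 ddiff_seq (('X - z%:P) * f).
Proof.
move=> mf sf [|[|k]] //=.
  rewrite !expr0 !mul1r mulrBl mul_polyC ddiffB ddiffZ; congr (_ - _ * _).
  by rewrite ddiff_coef ?sf // -(monicP mf) /lead_coef sf.
rewrite -ddiffZ -ddiffB; congr ddiff.
by rewrite -mul_polyC exprSr; ring.
Qed.

Lemma foldr_mul1sub_ddiff_seq zs : (size zs <= N.+1)%N ->
  foldr mul1sub (ddiff_seq 'X^(N.+1)) zs =1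
  ddiff_seq ('X^(N.+1 - size zs) * \prod_(z <- zs) ('X - z%:P)).
Proof.
elim: zs => [|z zs IH] /= szs k; first by rewrite big_nil mulr1 subn0.
have e : mul1sub z (foldr mul1sub (ddiff_seq 'X^(N.+1)) zs) k =
  mul1sub z (ddiff_seq ('X * ('X^(N - size zs) * \prod_(z <- zs) ('X - z%:P)))) k.
  by case: k => [|k] /=; rewrite !IH ?(ltnW szs) //= subSn // exprS !mulrA.
rewrite {}e mul1sub_ddiff_seq.
- by rewrite big_cons subSS mulrCA.
- by rewrite monicMr ?monicXn ?monic_prod_XsubC // .
- rewrite size_monicM ?monicXn ?monic_neq0 ?monic_prod_XsubC //.
  by rewrite size_polyXn size_prod_XsubC; lia.
Qed.

(** The sequence expands [prod (1 - z t) / prod (1 - x_k t)], whose logarithmic derivative under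
    [t d/dt] yields these power sums. *)
Lemma newton_ddiff_seq zs : size zs = N.+1 ->
  newton_defect (fun i => \sum_k x k ^+ i - \sum_(z <- zs) z ^+ i)
    (ddiff_seq (\prod_(z <- zs) ('X - z%:P))) =1 (fun=> 0).
Proof.
move=> szs; pose xs := [seq x k | k <- enum 'I_N.+1].
have sxs : size xs = N.+1 by rewrite size_map size_enum_ord.
(* The numerator 1 comes first: multiplying by all [1 - x_k t] leaves the series 1, whose defect for
   [p = 0] vanishes, and these factors can be cancelled. *)
have h0 : newton_defect (fun i => \sum_k x k ^+ i) (ddiff_seq 'X^(N.+1)) =1 (fun=> 0).
  rewrite -(foldr_mul1sub_eq0 xs) => k; rewrite -newton_defect_foldr.
  rewrite (@eq_newton_defect _ _ (fun=> 0) _ (fun k => (k == 0)%:R)).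
  - rewrite /newton_defect big1 ?subr0 => [|i _]; last by rewrite mul0r.
    by case: k => [|k]; rewrite ?mul0r ?mulr0.
  - by move=> i; rewrite big_map big_enum subrr.
  - case=> [|i]; rewrite foldr_mul1sub_ddiff_seq ?sxs //= ddiff_root // => l.
    rewrite !hornerM horner_prod big_map big_enum (bigD1 l) //=.
    by rewrite hornerXsubC subrr mul0r !mulr0.
move=> k.
rewrite (@eq_newton_defect _ _ _ _ (foldr mul1sub (ddiff_seq 'X^(N.+1)) zs) (fun=> erefl)).
  by rewrite newton_defect_foldr; move: k; apply/foldr_mul1sub_eq0.
by move=> i; rewrite foldr_mul1sub_ddiff_seq ?szs // subnn expr0 mul1r.
Qed.

End DividedDifference.

(** * Partitions and their Maya diagrams *)

Section Partitions.
Implicit Types (l : seq nat) (i j k : nat).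

Lemma partition_nth_le l i j :
  is_partition l -> (i <= j)%N -> (nth 0 l j <= nth 0 l i)%N.
Proof.
case/andP=> sl _ ij; have [jl|jl] := ltnP j (size l); last by rewrite nth_default.
apply: (@sorted_leq_nth _ geq _ _ 0%N) => //=; rewrite ?inE //.
- by move=> x y z; rewrite /geq /= => h1 h2; apply: leq_trans h2 h1.
- by move=> x; rewrite /geq /=.
- exact: leq_ltn_trans jl.
Qed.

(** Such a [P] holds on an initial segment, whose length is the count; [conjp] and [ndiag] are
    counts of this kind. *)
Lemma count_iota_antitone (P : pred nat) m i :
  (forall j k, (j <= k)%N -> P k -> P j) ->
  (i < count P (iota 0 m))%N = (i < m)%N && P i.
Proof.
move=> Pan; elim: m i => [|m IH] i //.
have -> : iota 0 m.+1 = iota 0 m ++ [:: m] by rewrite -addn1 iotaD.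
rewrite count_cat /= addn0.
have [Pm|Pm] := boolP (P m); last first.
  rewrite addn0 IH; case: (ltngtP i m) => [im|im|->].
  - by have -> : (i < m.+1)%N by lia.
  - by have -> : (i < m.+1)%N = false by lia.
  - by rewrite (negbTE Pm) !andbF.
have -> : count P (iota 0 m) = m.
  apply/eqP; rewrite eqn_leq -{2}(size_iota 0 m) count_size /=.
  case: m IH Pm => // m IH Pm; rewrite IH ltnSn /=.
  by apply: Pan Pm.
rewrite addn1 ltnS; case: leqP => //= im; by rewrite (Pan _ _ im Pm).
Qed.

Lemma conjpE l j : conjp l j.+1 = count (fun i => (j < nth 0 l i)%N) (iota 0 (size l)).
Proof. by rewrite /conjp -{1}(mkseq_nth 0%N l) /mkseq count_map. Qed.

Lemma ltn_conjp l i j : is_partition l ->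
  (i < conjp l j.+1)%N = (j < nth 0 l i)%N.
Proof.
move=> pl; rewrite conjpE count_iota_antitone.
  by case: ltnP => //= il; rewrite nth_default.
by move=> k m km; move/leq_trans; apply; apply: partition_nth_le.
Qed.

Lemma ltn_ndiag l i : is_partition l -> (i < ndiag l)%N = (i < nth 0 l i)%N.
Proof.
move=> pl; rewrite /ndiag (iotaDl 1 0) count_map.
rewrite (@eq_count _ _ (fun i => (i < nth 0 l i)%N)) // count_iota_antitone.
  by case: ltnP => //= il; rewrite nth_default.
move=> j k jk kl; apply: (leq_ltn_trans jk (leq_trans kl _)).
exact: partition_nth_le.
Qed.

Lemma conjp_le_size l j : (conjp l j <= size l)%N.
Proof. exact: count_size. Qed.

Lemma ndiag_le_size l : (ndiag l <= size l)%N.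
Proof. by rewrite /ndiag -{2}(size_iota 1 (size l)) count_size. Qed.

(** Rows and columns count from 0 here, so these are the indices [mu_i - i + 1] and [j - mu'_j] at
    which [hookprod] reads [a]. *)
Definition row_content l k : int := (nth 0%N l k)%:Z - k%:Z.
Definition col_content l j : int := j.+1%:Z - (conjp l j.+1)%:Z.

Lemma row_content_lt l i j : is_partition l -> (i < j)%N ->
  (row_content l j < row_content l i)%R.
Proof.
move=> pl ij; have := partition_nth_le pl (ltnW ij); rewrite /row_content; lia.
Qed.

Lemma row_content_inj l : is_partition l -> injective (row_content l).
Proof.
move=> pl i j e; case: (ltngtP i j) => // h;
  by have := row_content_lt pl h; rewrite e; lia.
Qed.

Lemma col_content_lt l i j : is_partition l -> (i < j)%N ->
  (col_content l i < col_content l j)%R.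
Proof.
move=> pl ij; suff : (conjp l j.+1 <= conjp l i.+1)%N by rewrite /col_content; lia.
by apply: sub_count => k /=; lia.
Qed.

(** The row content is the larger one if the box [(i, j)] lies in the diagram, and the smaller one
    otherwise. *)
Lemma row_col_content_neq l i j : is_partition l -> row_content l i != col_content l j.
Proof.
move=> pl; rewrite /row_content /col_content; apply/negP => /eqP.
by case: (ltnP i (conjp l j.+1)) (ltn_conjp i j pl); lia.
Qed.

(* Row contents are the particles, column contents the holes of the Maya diagram. *)
Lemma maya_perm l N r c : is_partition l -> (size l <= N)%N -> (r <= N)%N ->
    (nth 0 l r <= c)%N -> ((0 < r)%N -> (c <= nth 0 l r.-1)%N) ->
  perm_eq ([seq row_content l k | k <- iota r (N - r)] ++
           [seq col_content l j | j <- iota 0 c])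
          [seq 1 - N%:Z + t%:Z | t <- iota 0 (N - r + c)].
Proof.
move=> pl lN rN rc cr.
set s1 := _ ++ _; set s2 := map _ _.
have u2 : uniq s2 by rewrite map_inj_uniq ?iota_uniq // => i j; lia.
have u1 : uniq s1.
  rewrite cat_uniq !map_inj_uniq ?iota_uniq /= ?andbT; last first.
  - exact: row_content_inj.
  - move=> i j e; case: (ltngtP i j) => // h;
      by have := col_content_lt pl h; rewrite e; lia.
  apply/hasPn => _ /mapP[j _ ->]; apply/negP => /mapP[i _ /esym/eqP].
  by rewrite (negbTE (row_col_content_neq _ _ pl)).
have s12 : {subset s1 <= s2}.
  move=> m; rewrite mem_cat => /orP[] /mapP[k].
    rewrite mem_iota => hk ->; have kr : (r <= k)%N by lia.
    have := partition_nth_le pl kr => h.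
    apply/mapP; exists (nth 0 l k + (N - k.+1))%N; rewrite ?mem_iota /row_content; lia.
  rewrite mem_iota => hk ->.
  have hc := conjp_le_size l k.+1.
  (* Row [r - 1] has at least [c] boxes, so each of the first [c] columns has height at least
     [r]. *)
  have hr : (r <= conjp l k.+1)%N.
    case: r rN rc cr {s1 s2 u1 u2} => // r rN rc cr.
    by rewrite ltn_conjp //; have := cr isT => /=; lia.
  apply/mapP; exists (k + (N - conjp l k.+1))%N; rewrite ?mem_iota /col_content; lia.
apply: uniq_perm => //.
apply: (uniq_min_size u1 s12 _).2.
by rewrite size_map size_iota size_cat !size_map !size_iota.
Qed.

(** Each row below row [i] has a box. This keeps the indices of the [h_k] in the Jacobi-Trudi matrix
    within [sumn mu], hence within [n]. *)
Lemma nth_addn_size_le l i : is_partition l -> (i < size l)%N ->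
  (nth 0 l i + (size l - i.+1) <= sumn l)%N.
Proof.
case/andP=> _; elim: l i => // x l IH [|i] /= /andP[x0 pl].
  move=> _; rewrite subSS subn0 leq_add2l.
  by elim: l pl {IH} => //= y l IH /andP[y0 /IH]; lia.
by rewrite ltnS => /(IH _ pl); rewrite subSS; lia.
Qed.

Lemma sumn_nth l N : (size l <= N)%N -> sumn l = \sum_(i < N) nth 0%N l i.
Proof.
elim: l N => [|x l IH] N; first by rewrite big1 // => i; rewrite nth_nil.
by case: N => // N /IH; rewrite big_ord_recl /= => ->.
Qed.

End Partitions.

(** With [d = ndiag l], the x-coordinates come from the first [d] rows and the y-coordinates from
    the first [d] columns. By [maya_perm] with [r = c = d], these columns and the remaining rows
    fill [1 - N, ..., 0]. *)
Lemma pval_contents (a : int -> C) l N k : is_partition l -> (size l <= N)%N ->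
  Defs.pval (xcoord a l) (ycoord a l) k.+1 =
  \sum_(i < N) a (row_content l i) ^+ k.+1
    - \sum_(z <- [seq a (1 - N%:Z + t%:Z) | t <- iota 0 N]) z ^+ k.+1.
Proof.
move=> pl lN; have dl := ndiag_le_size l; set d := ndiag l in dl.
have dN := leq_trans dl lN.
have hd i : (i < d)%N = (i < nth 0 l i)%N by exact: ltn_ndiag.
have xE : \sum_(u <- xcoord a l) u ^+ k.+1 =
          \sum_(i <- iota 0 d) a (row_content l i) ^+ k.+1.
  rewrite /xcoord (iotaDl 1 0) -map_comp big_map big_seq [RHS]big_seq.
  apply: eq_bigr => i; rewrite mem_iota hd /= => hi; congr (a _ ^+ _).
  by rewrite /part /row_content /= add0n; lia.
have yE : (-1) ^+ k * \sum_(v <- ycoord a l) v ^+ k.+1 =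
          - \sum_(i <- iota 0 d) a (col_content l i) ^+ k.+1.
  rewrite /ycoord (iotaDl 1 0) -map_comp big_map mulr_sumr -sumrN.
  rewrite big_seq [RHS]big_seq.
  apply: eq_bigr => i; rewrite mem_iota hd -ltn_conjp //= => hi.
  (* The sign [(-1)^k] of [pval] and the sign [(-1)^(k+1)] from [dualseq] combine to -1. *)
  rewrite /dualseq [X in _ * X]exprNn mulrA -exprD addnS exprS addnn -signr_odd odd_double.
  rewrite expr0 mulr1 mulN1r; congr (- _).
  by congr (a _ ^+ _); rewrite /col_content add1n; lia.
rewrite /Defs.pval /= xE yE big_map.
have dc : (nth 0 l d <= d)%N by rewrite leqNgt -hd ltnn.
have dc' : (0 < d)%N -> (d <= nth 0 l d.-1)%N by move=> d0; rewrite -{1}(prednK d0) -hd prednK.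
have := perm_big _ (maya_perm pl lN dN dc dc')
  (op := +%R) (x := 0) (P := xpredT) (F := fun m => a m ^+ k.+1).
rewrite big_cat !big_map subnK //= => <-.
rewrite -(big_mkord xpredT (fun i => a (row_content l i) ^+ k.+1)) /index_iota subn0.
have -> : iota 0 N = iota 0 d ++ iota d (N - d) by rewrite -{1}(subnKC dN) iotaD.
rewrite big_cat /=.
by rewrite opprD addrA addrK.
Qed.

(** * Determinant identities and Vieta's formula *)

Section Determinants.

(** Expansion along the last row, whose only possibly nonzero entry is the diagonal 1. It pads the
    Jacobi-Trudi matrix to a larger size. *)
Lemma det_unitriangular_tail (R : comNzRingType) (f : nat -> nat -> R) (m n : nat) :
  (m <= n)%N -> (forall i j, (m <= i < n)%N -> (j < i)%N -> f i j = 0) ->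
  (forall i, (m <= i < n)%N -> f i i = 1) ->
  \det (\matrix_(i < n, j < n) f i j) = \det (\matrix_(i < m, j < m) f i j).
Proof.
move=> mn; elim: n mn => [|n IH]; first by rewrite leqn0 => /eqP ->.
rewrite leq_eqVlt => /predU1P[->//|mn] f0 f1; rewrite -IH //; first last.
- by move=> i imn; apply: f1; lia.
- by move=> i j imn; apply: f0; lia.
rewrite (expand_det_row _ ord_max) (bigD1 ord_max) //= big1 ?addr0; last first.
  move=> j; rewrite -val_eqE /= => jn; have := ltn_ord j => jn1.
  by rewrite mxE f0 ?mul0r //=; lia.
rewrite mxE f1 ?mul1r; last by rewrite /=; lia.
rewrite /cofactor addnn -signr_odd odd_double mul1r; congr (\det _).
by apply/matrixP => i j; rewrite !mxE !lift_max.
Qed.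

(** The transposed matrix is a unitriangular matrix of coefficients times a Vandermonde matrix. *)
Lemma det_monic_horner (K : fieldType) (n : nat) (p : nat -> {poly K}) (x : 'I_n -> K) :
  (forall j, p j \is monic) -> (forall j, size (p j) = j.+1) ->
  \det (\matrix_(k < n, j < n) (p j).[x k]) =
  \prod_(i < n) \prod_(j < n | (i < j)%N) (x j - x i).
Proof.
move=> mp sp; rewrite -det_tr.
have -> : (\matrix_(k < n, j < n) (p j).[x k])^T =
   (\matrix_(j < n, t < n) (p j)`_t) *m Vandermonde n (\row_k x k).
  apply/matrixP => j k; rewrite !mxE (@horner_coef_wide _ n) ?sp //.
  by apply: eq_bigr => t _; rewrite !mxE.
rewrite det_mulmx det_Vandermonde det_trig; last first.
  by apply/is_trig_mxP => i j ij; rewrite mxE nth_default // sp.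
rewrite big1 ?mul1r; last first.
  by move=> i _; rewrite mxE -(monicP (mp i)) /lead_coef sp.
by do 2!(apply: eq_bigr => ? _); rewrite !mxE.
Qed.

Lemma coef_prod_XsubC_esym (s : seq C) (i : nat) : (i <= size s)%N ->
  (\prod_(c <- s) ('X - c%:P))`_i = (-1) ^+ (size s - i) * esym_at (size s - i) s.
Proof.
move=> hi; rewrite (big_nth 0) big_mkord.
under eq_bigr do rewrite addrC.
(* The expansion runs over the set [J] of factors contributing their constant term. *)
rewrite (@bigA_distr {poly C} 0 1 *%R +%R) coef_sum /esym_at mulr_sumr big_mkcond.
rewrite [RHS]big_mkcond; apply: eq_bigr => J _ /=.
rewrite (bigID (mem J)) /=.
rewrite (eq_bigr (fun j : 'I_(size s) => (- s`_j)%:P)); last by move=> j ->; rewrite polyCN.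
rewrite [X in _ * X](eq_bigr (fun=> 'X)); last by move=> j /negbTE ->.
rewrite -rmorph_prod /= prodrN prodr_const coefCM coefXn.
have eJ : (#|J| + #|[pred j | j \notin J]| = size s)%N.
  by rewrite -[RHS]card_ord -(cardC (mem J)).
have -> : #|[pred j | j \notin J]| = (size s - #|J|)%N by lia.
have -> : (i == size s - #|J|)%N = (#|J| == size s - i)%N.
  by move: (max_card (mem J)); rewrite card_ord => hJ; apply/eqP/eqP; lia.
by case: eqP => [->|_]; rewrite ?mulr1 ?mulr0.
Qed.

End Determinants.

(** * Evaluation of [schur_a] at a diagram *)

Definition linprod (a : int -> C) (lo : int) (m : nat) : {poly C} :=
  \prod_(c <- [seq a (lo + t%:Z) | t <- iota 0 m]) ('X - c%:P).

Lemma linprodD a lo m n : linprod a lo (m + n) = linprod a lo m * linprod a (lo + m%:Z) n.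
Proof.
rewrite /linprod !big_map iotaD big_cat /=; congr (_ * _).
have -> : iota m n = [seq (m + t)%N | t <- iota 0 n] by rewrite -iotaDl addn0.
by rewrite big_map; apply: eq_bigr => t _; rewrite PoszD addrA.
Qed.

Lemma monic_linprod a lo m : linprod a lo m \is monic.
Proof. exact: monic_prod_XsubC. Qed.

Lemma size_linprod a lo m : size (linprod a lo m) = m.+1.
Proof. by rewrite size_prod_XsubC size_map size_iota. Qed.

Lemma horner_linprod a lo m c :
  (linprod a lo m).[c] = \prod_(t <- iota 0 m) (c - a (lo + t%:Z)).
Proof.
by rewrite /linprod big_map horner_prod; apply: eq_bigr => t _; rewrite hornerXsubC.
Qed.

Lemma natrC_neq0 k : k.+1%:R != 0 :> C.
Proof. exact: (negbT (Num.Theory.pnatr_eq0 (Rdefinitions.R)[i] k.+1)). Qed.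

Section Evaluation.
Variables (a : int -> C) (l : seq nat) (N n : nat).
Hypotheses (a_inj : injective a) (pl : is_partition l) (lN : (size l <= N.+1)%N).

Lemma nth_hrev k i : (i <= k)%N -> nth 0 (hrev n k) i = hcomp n (k - i)%N.
Proof. by elim: k i => [|k IH] [|i] //= ik; rewrite IH. Qed.

Lemma hcompS k : hcomp n k.+1 =
  k.+1%:R^-1 *: \sum_(i < k.+1) psum n i.+1 * hcomp n (k - i)%N.
Proof.
rewrite {1}/hcomp /=; congr (_ *: _); apply: eq_bigr => i _.
by rewrite nth_hrev // -ltnS.
Qed.

Let x (k : 'I_N.+1) : C := a (row_content l k).

Lemma row_point_inj : injective x.
Proof. by move=> i j /a_inj/(row_content_inj pl)/val_inj. Qed.

Local Notation Z := (linprod a (1 - N.+1%:Z) N.+1).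

(** Both sides start at 1 and satisfy Newton's recurrence, the right one by [newton_ddiff_seq] and
    [pval_contents]. For [k <= n] only power sums that are variables occur. *)
Lemma evalat_hcomp k : (k <= n)%N -> evalat a (hcomp n k) l = ddiff_seq x Z k.
Proof.
pose p := Defs.pval (xcoord a l) (ycoord a l).
move: k; apply: (@eq_newton _ p (fun k => evalat a (hcomp n k) l) (ddiff_seq x Z)).
- exact: natrC_neq0.
- by rewrite /evalat /evalxy /= meval1.
move=> [|k] kn; first by rewrite /newton_defect !big_ord0 !mul0r.
transitivity (0 : C); last first.
  pose zs := [seq a (1 - N.+1%:Z + t%:Z) | t <- iota 0 N.+1].
  have szs : size zs = N.+1 by rewrite size_map size_iota.
  rewrite -(newton_ddiff_seq row_point_inj szs k.+1).
  by apply: eq_newton_defect => // i; rewrite /p -pval_contents.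
rewrite /newton_defect {1}/evalat /evalxy hcompS mevalZ mulrA divff ?natrC_neq0 // mul1r.
rewrite raddf_sum /= -sumrB big1 // => i _; apply/eqP; rewrite subr_eq0; apply/eqP.
rewrite mevalM; congr (_ * _).
have ik : (i < n)%N by have := ltn_ord i; lia.
by rewrite /= insubT /= mevalXU.
Qed.

(** The signed elementary symmetric values are the coefficients of [prod (u - b_j)], and [h_(i+1)]
    evaluates to [ddiff] of [u^i Z]. *)
Lemma evalat_hsh (b : int -> C) k : (k < n)%N ->
  evalat a (hsh n b k.+1) l =
  ddiff x (Z * \prod_(c <- [seq b j%:Z | j <- iota 1 k]) ('X - c%:P)).
Proof.
move=> kn; set P := \prod_(c <- _) _.
have sP : size P = k.+1 by rewrite size_prod_XsubC size_map size_iota.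
rewrite -[P]coefK poly_def sP mulr_sumr ddiff_sum /evalat /evalxy /= raddf_sum /=.
apply: eq_bigr => i _; have ik : (i <= k)%N by rewrite -ltnS.
rewrite mevalZ -scalerAr ddiffZ; congr (_ * _).
  by rewrite /P coef_prod_XsubC_esym size_map size_iota.
have := @evalat_hcomp i.+1; rewrite /evalat /evalxy => -> /=; last by lia.
by rewrite mulrC.
Qed.

Section Schur.
Variable mu : seq nat.
Hypotheses (pmu : is_partition mu) (muN : (size mu <= N.+1)%N) (mun : (sumn mu <= n)%N).

Local Notation A i := (linprod a (1 - N.+1%:Z) (nth 0%N mu i + (N - i))).
Local Notation B j := (linprod a (1 - j%:Z) j).

(** The product is monic of degree [mu_i + N - i + j], at most [N] here, and [ddiff] reads its
    coefficient of [u^N]. This matches [h_0 = 1] and [h_k = 0] for negative [k]. *)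
Lemma ddiff_row_col0 i j : (i <= N)%N -> (nth 0%N mu i + j <= i)%N ->
  ddiff x (A i * B j) = (nth 0%N mu i + j == i)%N%:R.
Proof.
move=> iN ij; have sAB : size (A i * B j) = (nth 0%N mu i + (N - i) + j).+1%N.
  rewrite size_monicM ?monic_linprod ?monic_neq0 ?monic_linprod // !size_linprod; lia.
rewrite (ddiff_coef row_point_inj) ?sAB; last by lia.
case: eqP => [e|ne]; last by rewrite nth_default // sAB; lia.
have mAB : A i * B j \is monic by rewrite monicMr ?monic_linprod.
rewrite -(monicP mAB) /lead_coef sAB /=; congr (_`_ _); lia.
Qed.

Lemma evalat_schur_entry i j : (i < size mu)%N -> (j < size mu)%N ->
  evalat a (hsh n (tau (1 - j.+1%:Z) a) ((part mu i.+1)%:Z - i.+1%:Z + j.+1%:Z)) l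
  = ddiff x (A i * B j).
Proof.
move=> imu jmu; have h := nth_addn_size_le pmu imu.
rewrite /part /=.
have [kp|kn] := ltnP i (nth 0%N mu i + j)%N; last first.
  rewrite ddiff_row_col0 //; last by lia.
  case: eqP => [e|ne].
    have -> : (nth 0%N mu i)%:Z - i.+1%:Z + j.+1%:Z = 0 by lia.
    by rewrite /evalat /evalxy meval1.
  have -> : (nth 0%N mu i)%:Z - i.+1%:Z + j.+1%:Z = Negz (i - (nth 0%N mu i + j)).-1 by lia.
  by rewrite /evalat /evalxy meval0.
have -> : (nth 0%N mu i)%:Z - i.+1%:Z + j.+1%:Z = (nth 0%N mu i + j - i.+1).+1%N by lia.
rewrite evalat_hsh; last by lia.
congr ddiff; set k := (nth 0%N mu i + j - i.+1)%N.
have -> : \prod_(c <- [seq tau (1 - j.+1%:Z) a j0%:Z | j0 <- iota 1 k]) ('X - c%:P)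
   = linprod a (1 - j%:Z) k.
  rewrite /linprod (iotaDl 1 0) !big_map; apply: eq_bigr => t _.
  by rewrite /tau; congr ('X - (a _)%:P); lia.
(* The indices [-N, ..., 0] of [Z] are cut before [1 - j]: the tail is [B j], and the head followed
   by the [k] shifted factors is [A i]. *)
have -> : (nth 0%N mu i + (N - i) = (N.+1 - j) + k)%N by rewrite /k; lia.
have e : (N.+1 = (N.+1 - j) + j)%N by lia.
rewrite linprodD {2}e linprodD.
have -> : 1 - N.+1%:Z + (N.+1 - j)%N%:Z = 1 - j%:Z by lia.
by rewrite mulrAC.
Qed.

(** After padding to size [N + 1], the sum over nodes in [ddiff] factors the matrix as [[A_i(x_k)]],
    a diagonal matrix and [[B_j(x_k)]]; the last has a Vandermonde determinant, [B j] being monic of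
    degree [j]. *)
Lemma evalat_schur_a : evalat a (schur_a n a mu) l =
  \det (\matrix_(i < N.+1, k < N.+1) (A i).[x k]) *
  ((\prod_(i < N.+1) \prod_(j < N.+1 | (i < j)%N) (x j - x i)) /
   \prod_(k < N.+1) \prod_(m < N.+1 | m != k) (x k - x m)).
Proof.
rewrite /evalat /evalxy /schur_a -det_map_mx.
rewrite (_ : map_mx _ _ = \matrix_(i < size mu, j < size mu) ddiff x (A i * B j)); last first.
  by apply/matrixP => i j; rewrite !mxE -evalat_schur_entry.
rewrite -(@det_unitriangular_tail _ (fun i j => ddiff x (A i * B j)) _ N.+1) //.
rewrite (_ : \matrix_(i < N.+1, j < N.+1) ddiff x (A i * B j) =
  \matrix_(i < N.+1, k < N.+1) (A i).[x k] *m
  diag_mx (\row_k (\prod_(m < N.+1 | m != k) (x k - x m))^-1) *m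
  \matrix_(k < N.+1, j < N.+1) (B j).[x k]); last first.
  apply/matrixP => i j; rewrite !mxE; apply: eq_bigr => k _.
  by rewrite mul_mx_diag !mxE hornerM mulrAC.
- rewrite !det_mulmx det_diag (@det_monic_horner _ _ (fun j => B j)).
  + rewrite -mulrA; congr (_ * _); rewrite mulrC -prodfV; congr (_ * _).
    by apply: eq_bigr => k _; rewrite mxE.
  + by move=> j; apply: monic_linprod.
  + by move=> j; apply: size_linprod.
- move=> i j /andP[mui iN] ji; rewrite ddiff_row_col0 ?nth_default ?add0n //; last exact: ltnW.
  by rewrite ltn_eqF.
- move=> i /andP[mui iN]; rewrite ddiff_row_col0 ?nth_default ?add0n ?eqxx //.
Qed.

End Schur.
End Evaluation.

(** * Vanishing of [schur_a] and its value at its own diagram *)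

Lemma partition_ext l l' : is_partition l -> is_partition l' ->
  (forall i, nth 0%N l i = nth 0%N l' i) -> l = l'.
Proof.
have sz k k' : is_partition k' -> (forall i, nth 0%N k i = nth 0%N k' i) ->
    (size k' <= size k)%N.
  case/andP=> _ /allP pk' e; rewrite leqNgt; apply/negP => h.
  by have := pk' _ (mem_nth 0%N h); rewrite -e nth_default.
move=> pl pl' e; apply: (@eq_from_nth _ 0%N) => [|i _]; last exact: e.
by apply/eqP; rewrite eqn_leq !sz.
Qed.

(** Row contents decrease strictly, so the set of them determines their order and then the parts. *)
Lemma row_content_perm_eq l l' N (s : 'S_N) : is_partition l -> is_partition l' ->
  (size l <= N)%N -> (size l' <= N)%N ->
  (forall i : 'I_N, row_content l i = row_content l' (s i)) -> l = l'.
Proof.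
move=> pl pl' lN lN' e.
have e12 : [seq row_content l i | i <- iota 0 N] = [seq row_content l' i | i <- iota 0 N].
  apply: (@irr_sorted_eq _ (fun x y : int => (y < x)%R)).
  - by move=> x y z; lia.
  - by move=> x; lia.
  - apply: (homo_sorted (e := ltn)); last exact: iota_ltn_sorted.
    by move=> i j; apply: row_content_lt.
  - apply: (homo_sorted (e := ltn)); last exact: iota_ltn_sorted.
    by move=> i j; apply: row_content_lt.
  move=> m; apply/mapP/mapP; case=> i; rewrite mem_iota add0n /= => iN ->.
    by exists (s (Ordinal iN)); rewrite ?mem_iota ?add0n ?ltn_ord // -e.
  exists (s^-1%g (Ordinal iN)); rewrite ?mem_iota ?add0n ?ltn_ord // e.
  by rewrite permKV.
apply: partition_ext => // i; have [iN|iN] := ltnP i N; last first.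
  by rewrite !nth_default ?(leq_trans _ iN).
have /eq_in_map/(_ i) := e12; rewrite mem_iota add0n iN => /(_ isT).
by rewrite /row_content; lia.
Qed.

Lemma hookprodE (a : int -> C) mu : hookprod a mu =
  \prod_(i < size mu) \prod_(j <- iota 0 (nth 0%N mu i))
  (a (row_content mu i) - a (col_content mu j)).
Proof.
apply: eq_bigr => i _.
transitivity (\prod_(j < nth 0%N mu i) (a (row_content mu i) - a (col_content mu j))).
  apply: eq_bigr => j _; congr (a _ - _).
  by rewrite /part /row_content /=; lia.
rewrite -(big_mkord xpredT (fun j => a (row_content mu i) - a (col_content mu j))).
by rewrite /index_iota subn0.
Qed.

Lemma hookprod_neq0 (a : int -> C) mu : injective a -> is_partition mu ->
  hookprod a mu != 0.
Proof.
move=> a_inj pmu; rewrite hookprodE; apply/prodf_neq0 => i _; rewrite prodf_seq_neq0.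
apply/allP => j _ /=; rewrite subr_eq0 (inj_eq a_inj).
exact: row_col_content_neq.
Qed.

Section Interpolation.
Variables (a : int -> C) (n : nat) (mu : seq nat).
Hypotheses (a_inj : injective a) (pmu : is_partition mu) (mun : (sumn mu <= n)%N).

(** A nonzero term of the determinant gives a permutation [s] under which each row content of [lam]
    is at least that of [mu]. Comparing sums, the sizes force equality throughout. *)
Lemma evalat_schur_a_eq0 lam : is_partition lam -> lam <> mu ->
  (sumn lam <= sumn mu)%N -> evalat a (schur_a n a mu) lam = 0.
Proof.
move=> plam lammu lemu; pose N := (size mu + size lam)%N.
have lamN : (size lam <= N.+1)%N by rewrite /N; lia.
have muN : (size mu <= N.+1)%N by rewrite /N; lia.
rewrite (evalat_schur_a a_inj plam lamN pmu muN mun).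
rewrite (_ : \det _ = 0) ?mul0r // /determinant big1 // => s _.
apply/eqP; rewrite mulf_eq0; apply/orP; right; apply/negPn/negP => /prodf_neq0 nz.
have le (i : 'I_N.+1) : (row_content mu i <= row_content lam (s i))%R.
  have := nz i isT; rewrite mxE horner_linprod prodf_seq_neq0 => /allP h.
  rewrite leNgt; apply/negP => lt; have iN := ltn_ord i; have sN := ltn_ord (s i).
  (* This is the position, counted from [-N], of the factor of [A i] that vanishes at the node of
     row [s i]. *)
  have /h : (nth 0%N lam (s i) + (N - s i))%N \in iota 0 (nth 0%N mu i + (N - i)).
    by rewrite mem_iota /=; move: lt; rewrite /row_content; lia.
  rewrite /= subr_eq0; case/eqP; congr a; rewrite /row_content; lia.
have sumE l : (size l <= N.+1)%N ->
    \sum_(i < N.+1) row_content l i = (sumn l)%:Z - \sum_(i < N.+1) i%:Z.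
  by move=> lN; rewrite sumrB (sumn_nth lN) -(big_morph Posz PoszD (erefl 0%Z)).
have sum0 : \sum_(i < N.+1) (row_content lam (s i) - row_content mu i) = 0.
  apply/eqP; rewrite eq_le sumr_ge0 ?andbT; last by move=> i _; rewrite subr_ge0.
  have -> : \sum_(i < N.+1) (row_content lam (s i) - row_content mu i) =
      \sum_(i < N.+1) row_content lam i - \sum_(i < N.+1) row_content mu i.
    by rewrite sumrB [in RHS](reindex_perm s).
  by rewrite !sumE //; lia.
case: lammu; apply/esym; apply: (@row_content_perm_eq _ _ N.+1 s) => // i.
have /psumr_eq0P := sum0 => /(_ _ i isT) h.
by apply/esym/eqP; rewrite -subr_eq0 h // => j _; rewrite subr_ge0.
Qed.

(** The matrix is triangular. By [maya_perm] with [r = i + 1] and [c = mu_i], the roots of [A_i]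
    come from the lower rows, whose factors form [U] and cancel, and from the columns meeting row
    [i], whose factors form the hook product. *)
Lemma evalat_schur_a_diag : evalat a (schur_a n a mu) mu = hookprod a mu.
Proof.
pose N := size mu; have muN : (size mu <= N.+1)%N by rewrite /N.
rewrite (evalat_schur_a a_inj pmu muN pmu muN mun).
set x := fun k : 'I_N.+1 => a (row_content mu k).
set V := \prod_(i < N.+1) \prod_(j < N.+1 | (i < j)%N) _.
pose U := \prod_(k < N.+1) \prod_(m < N.+1 | (k < m)%N) (x k - x m).
have UV : \prod_(k < N.+1) \prod_(m < N.+1 | m != k) (x k - x m) = U * V.
  have -> : V = \prod_(k < N.+1) \prod_(m < N.+1 | (m < k)%N) (x k - x m).
    by rewrite /V (exchange_big_dep xpredT).
  rewrite /U -big_split /=; apply: eq_bigr => k _.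
  rewrite (bigID (fun m : 'I_N.+1 => (k < m)%N)) /=; congr (_ * _); apply: eq_bigl => m.
    by rewrite -val_eqE /=; lia.
  by rewrite -val_eqE /=; lia.
have : U * V != 0.
  rewrite -UV; apply/prodf_neq0 => k _; apply: ddiff_prod_neq0.
  exact: row_point_inj.
rewrite mulf_eq0 => /norP[U0 V0]; rewrite UV.
rewrite det_trig; last first.
  apply/is_trig_mxP => i k ik; rewrite mxE horner_linprod.
  have iN := ltn_ord i; have kN := ltn_ord k; have lt := row_content_lt pmu ik.
  apply/eqP; rewrite prodf_seq_eq0; apply/hasP.
  exists (nth 0%N mu k + (N - k))%N.
    by rewrite mem_iota /=; move: lt; rewrite /row_content; lia.
  by rewrite /= subr_eq0; apply/eqP; congr a; rewrite /row_content; lia.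
rewrite (eq_bigr (fun i : 'I_N.+1 => \prod_(m < N.+1 | (i < m)%N) (x i - x m) *
   \prod_(j <- iota 0 (nth 0%N mu i)) (a (row_content mu i) - a (col_content mu j)))); last first.
  move=> i _; rewrite mxE horner_linprod.
  have le : (nth 0%N mu i.+1 <= nth 0%N mu i)%N by apply: partition_nth_le.
  have := maya_perm pmu muN (ltn_ord i) le (fun _ => leqnn _).
  move=> pe; have := perm_big _ pe (op := *%R) (x := 1) (P := xpredT) (F := fun m => x i - a m).
  rewrite big_cat !big_map subSS addnC /= => <-; congr (_ * _).
  transitivity (\prod_(i.+1 <= m < N.+1) (x i - a (row_content mu m))).
    by rewrite /index_iota subSS.
  by rewrite big_geq_mkord.
rewrite big_split /= -/U hookprodE.
set W := \prod_(i < N.+1) \prod_(j <- _) _.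
have -> : U * W * (V / (U * V)) = W by field; rewrite V0 U0.
(* As [N = size mu], the extra row of index [N] is empty. *)
by rewrite /W big_ord_recr /= nth_default // big_nil mulr1.
Qed.

End Interpolation.

(** * Weighted degree and leading parts *)

Section Grading.
Variable n : nat.
Implicit Types (F G : {mpoly C[n]}) (P Q : pred int).

(** Degrees are integers because Jacobi-Trudi entries can have negative nominal degree. *)
Definition wsupp P F := forall m, m \in msupp F -> P (wdeg m)%:Z.

Lemma wdegD (m1 m2 : 'X_{1..n}) : wdeg (m1 + m2)%MM = (wdeg m1 + wdeg m2)%N.
Proof.
by rewrite /wdeg -big_split; apply: eq_bigr => i _ /=; rewrite mnmDE mulnDr.
Qed.

Lemma wdeg0 : wdeg (0%MM : 'X_{1..n}) = 0%N.
Proof. by rewrite /wdeg big1 // => i _; rewrite mnm0E muln0. Qed.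

Lemma wdeg1 (i : 'I_n) : wdeg U_(i)%MM = i.+1.
Proof.
rewrite /wdeg (bigD1 i) //= mnm1E eqxx muln1 big1 ?addn0 // => j ji.
by rewrite mnm1E eq_sym (negbTE ji) muln0.
Qed.

Lemma wsupp0 P : wsupp P 0.
Proof. by move=> m; rewrite msupp0. Qed.

Lemma sub_wsupp P Q F : (forall d, P d -> Q d) -> wsupp P F -> wsupp Q F.
Proof. by move=> PQ hF m /hF/PQ. Qed.

Lemma wsuppD P F G : wsupp P F -> wsupp P G -> wsupp P (F + G).
Proof. by move=> hF hG m /msuppD_le; rewrite mem_cat => /orP[/hF|/hG]. Qed.

Lemma wsuppZ P c F : wsupp P F -> wsupp P (c *: F).
Proof. by move=> hF m /msuppZ_le /hF. Qed.

Lemma wsuppB P F G : wsupp P F -> wsupp P G -> wsupp P (F - G).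
Proof. by move=> hF hG; rewrite -scaleN1r; apply: wsuppD => //; apply: wsuppZ. Qed.

Lemma wsupp_sum P (I : Type) (r : seq I) (p : pred I) (f : I -> {mpoly C[n]}) :
  (forall i, p i -> wsupp P (f i)) -> wsupp P (\sum_(i <- r | p i) f i).
Proof. by move=> h; apply: big_ind => //; [exact: wsupp0 | exact: wsuppD]. Qed.

Lemma wsuppM P Q (R : pred int) F G : (forall d e, P d -> Q e -> R (d + e)) ->
  wsupp P F -> wsupp Q G -> wsupp R (F * G).
Proof.
move=> PQR hF hG m /msuppM_le/allpairsP[[m1 m2] /= [h1 h2 ->]].
by rewrite wdegD PoszD; apply: PQR; [exact: hF | exact: hG].
Qed.

Lemma wsupp1 P : P 0 -> wsupp P 1.
Proof. by move=> P0 m; rewrite msupp1 inE => /eqP ->; rewrite wdeg0. Qed.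

Lemma wsupp_psum k : wsupp (pred1 k.+1%:Z) (psum n k.+1).
Proof.
rewrite /=; case: insubP => [i _ <-|_]; last exact: wsupp0.
by move=> m; rewrite msuppX inE => /eqP ->; rewrite wdeg1 /=.
Qed.

Lemma wsupp_hcomp k : wsupp (pred1 k%:Z) (hcomp n k).
Proof.
elim/ltn_ind: k => -[|k] IH; first exact: wsupp1.
rewrite hcompS; apply/wsuppZ/wsupp_sum => i _; have := ltn_ord i => ik.
apply: (wsuppM _ (@wsupp_psum i) (IH (k - i)%N _)); last by lia.
by move=> d e /= /eqP -> /eqP ->; apply/eqP; lia.
Qed.

(** Here [G] may be 0, which keeps the relation stable under sums with cancellation and hence under
    determinants. *)
Definition leading d F G :=
  wsupp (pred1 d) G /\ wsupp (fun e => (e < d)%R) (F - G).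

Lemma leading_le d F G : leading d F G -> wsupp (fun e => (e <= d)%R) F.
Proof.
case=> hG hFG; rewrite -(subrK G F); apply: wsuppD.
  by apply: sub_wsupp hFG => e; apply: ltW.
by apply: sub_wsupp hG => e /eqP ->.
Qed.

Lemma leading0 d : leading d 0 0.
Proof. by rewrite /leading subrr; split; apply: wsupp0. Qed.

Lemma leadingD d F1 G1 F2 G2 :
  leading d F1 G1 -> leading d F2 G2 -> leading d (F1 + F2) (G1 + G2).
Proof.
move=> [h1 k1] [h2 k2]; split; first exact: wsuppD.
by rewrite opprD addrACA; apply: wsuppD.
Qed.

Lemma leadingZ d c F G : leading d F G -> leading d (c *: F) (c *: G).
Proof. by case=> h k; split; rewrite -?scalerBr; apply: wsuppZ. Qed.

Lemma leadingM d e F1 G1 F2 G2 :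
  leading d F1 G1 -> leading e F2 G2 -> leading (d + e) (F1 * F2) (G1 * G2).
Proof.
move=> l1 l2; have h2' := leading_le l2; case: l1 l2 => [h1 k1] [h2 k2]; split.
  by apply: (wsuppM _ h1 h2) => i j /eqP -> /eqP ->; apply/eqP.
rewrite (_ : _ - _ = (F1 - G1) * F2 + G1 * (F2 - G2)); last by ring.
apply: wsuppD; first by apply: (wsuppM _ k1 h2') => i j; lia.
by apply: (wsuppM _ h1 k2) => i j /eqP ->; lia.
Qed.

Lemma leading1 : leading 0 1 1.
Proof. by rewrite /leading subrr; split; [apply: wsupp1 | apply: wsupp0]. Qed.

Lemma leading_prod (I : finType) (d : I -> int) (f g : I -> {mpoly C[n]}) :
  (forall i, leading (d i) (f i) (g i)) ->
  leading (\sum_i d i) (\prod_i f i) (\prod_i g i).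
Proof.
move=> h; apply: (big_rec3 (fun d F G => leading d F G)); first exact: leading1.
by move=> i e F G _ l; apply: leadingM.
Qed.

Lemma leading_det (N : nat) (d : 'I_N -> 'I_N -> int) (D : int) (A B : 'M[{mpoly C[n]}]_N) :
  (forall s : {perm 'I_N}, \sum_i d i (s i) = D) ->
  (forall i j, leading (d i j) (A i j) (B i j)) -> leading D (\det A) (\det B).
Proof.
move=> hD h; rewrite /determinant.
apply: (big_ind2 (leading D)); [exact: leading0 | by move=> *; apply: leadingD |].
move=> s _; rewrite -(hD s).
have e (p : {mpoly C[n]}) : (-1) ^+ s * p = ((-1) ^+ s : C) *: p.
  by case: (s : bool); rewrite ?expr1 ?expr0 ?mulN1r ?scaleN1r ?mul1r ?scale1r.
by rewrite !e; apply/leadingZ/leading_prod.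
Qed.

Lemma esym_at0 s : esym_at 0 s = 1.
Proof.
rewrite /esym_at (big_pred1 set0) ?big_set0 // => I /=.
by rewrite cards_eq0.
Qed.

Lemma leading_hsh b k : leading k (hsh n b k) (hZ n k).
Proof.
case: k => [[|k]|k] /=; last exact: leading0.
  exact: leading1.
split; first exact: wsupp_hcomp.
(* The last summand is [h_k] itself, with coefficient [e_0 = 1]; the others have lower degree. *)
rewrite big_ord_recr /= subnn expr0 esym_at0 mulr1 scale1r addrK.
apply: wsupp_sum => i _; apply: wsuppZ; have := ltn_ord i => ik.
by apply: sub_wsupp (@wsupp_hcomp i.+1) => d /eqP ->; lia.
Qed.

(** Along any permutation the shifts [-i] and [+j] cancel, so every term of the determinant has
    degree [sumn mu]. *)
Lemma leading_schur a mu : leading (sumn mu) (schur_a n a mu) (schur n mu).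
Proof.
apply: (leading_det (d := fun i j =>
   (part mu i.+1)%:Z - i.+1%:Z + j.+1%:Z)); last first.
  by move=> i j; rewrite !mxE; apply: leading_hsh.
move=> s; rewrite big_split sumrB /= (sumn_nth (leqnn _)).
rewrite [X in _ - X](reindex_perm s) /= subrK.
by rewrite (big_morph Posz PoszD (erefl 0%Z)).
Qed.

End Grading.

(* The variable 'X_i is the power sum of degree i + 1. *)
Definition partition_of_mnm (n : nat) (m : 'X_{1..n}) : seq nat :=
  sort geq (flatten [seq nseq (m i) (i : nat).+1 | i <- enum 'I_n]).

(** * Monomials in the power sums as partitions *)

Section PartitionOfMonomial.
Variable n : nat.
Implicit Type m : 'X_{1..n}.

Lemma is_partition_of_mnm m : is_partition (partition_of_mnm m).
Proof.
apply/andP; split; first by apply: sort_sorted => x y; apply: leq_total.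
rewrite all_sort; apply/allP => k /flattenP[s /mapP[i _ ->]].
by rewrite mem_nseq => /andP[_ /eqP ->].
Qed.

Lemma sumn_partition_of_mnm m : sumn (partition_of_mnm m) = wdeg m.
Proof.
rewrite (perm_sumn (permEl (perm_sort _ _))) sumn_flatten sumnE 2!big_map big_enum.
by apply: eq_bigr => i _; rewrite sumn_nseq.
Qed.

(** The exponent [m i] is recovered as the multiplicity of the part [i + 1]. *)
Lemma partition_of_mnm_inj : injective (@partition_of_mnm n).
Proof.
have cE m (i : 'I_n) : count_mem i.+1 (partition_of_mnm m) = m i.
  rewrite count_sort count_flatten sumnE 2!big_map big_enum (bigD1 i) //= big1.
    by rewrite count_nseq /= eqxx mul1n addn0.
  by move=> j ji; rewrite count_nseq /= eqSS val_eqE (negbTE ji).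
by move=> m m' e; apply/mnmP => i; rewrite -!cE e.
Qed.

Lemma mdeg_le_wdeg m : (mdeg m <= wdeg m)%N.
Proof. by rewrite mdegE; apply: leq_sum => i _; rewrite leq_pmull. Qed.

End PartitionOfMonomial.

(** * Uniqueness by invertibility of the evaluation matrix *)

Section Uniqueness.
Variables (a : int -> C) (n d : nat).
Hypotheses (a_inj : injective a) (dn : (d <= n)%N).

(** The bounded multinomials give a finite type; by [mdeg_le_wdeg] it contains every monomial of
    weight at most [d]. *)
Local Notation I := [set m : 'X_{1..n < d.+1} | (wdeg m <= d)%N].
Let ev (r : 'I_#|I|) : 'X_{1..n} := bmnm (enum_val r).
Let lam (r : 'I_#|I|) : seq nat := partition_of_mnm (ev r).

Lemma ev_wdeg r : (wdeg (ev r) <= d)%N.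
Proof. by have := enum_valP r; rewrite inE. Qed.

Lemma ev_inj : injective ev.
Proof. by move=> r s /val_inj/enum_val_inj. Qed.

Lemma evP m : (wdeg m <= d)%N -> exists r, ev r = m.
Proof.
move=> md; have mb : (mdeg m < d.+1)%N by rewrite ltnS (leq_trans (mdeg_le_wdeg m)).
have mI : BMultinom mb \in I by rewrite inE.
by exists (enum_rank_in mI (BMultinom mb)); rewrite /ev enum_rankK_in.
Qed.

Lemma meval_deg_le (F : {mpoly C[n]}) v : deg_le F d ->
  F.@[v] = \sum_r F@_(ev r) * 'X_[ev r].@[v].
Proof.
move=> hF; have sF : (msize F <= d.+1)%N.
  rewrite msizeE; apply/bigmax_leqP_seq => m mF _; rewrite ltnS.
  exact: leq_trans (mdeg_le_wdeg m) (hF m mF).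
rewrite {1}(mpolywE sF) raddf_sum /= (bigID (mem I)) /= [X in _ + X]big1; last first.
  move=> m; rewrite inE => mI; rewrite mevalZ memN_msupp_eq0 ?mul0r //.
  by apply: contra mI; apply: hF.
rewrite addr0 big_enum_val /=; apply: eq_bigr => r _; exact: mevalZ.
Qed.

(** The product of the square matrices [M] and [E] tabulates the values of the [schur_a], so it is
    invertible by triangularity. Then [E] is invertible too, and it kills the row of coefficients of
    [F]. *)
Lemma deg_le_eq0 (F : {mpoly C[n]}) : deg_le F d ->
  (forall l, is_partition l -> (sumn l <= d)%N -> evalat a F l = 0) -> F = 0.
Proof.
move=> hF F0.
pose E := \matrix_(r, s) evalat a ('X_[ev r] : {mpoly C[n]}) (lam s).
pose M := \matrix_(r, s) (schur_a n a (lam r))@_(ev s).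
have lam_n r : (sumn (lam r) <= n)%N.
  by rewrite sumn_partition_of_mnm (leq_trans (ev_wdeg r)).
have ME r s : (M *m E) r s = evalat a (schur_a n a (lam r)) (lam s).
  rewrite [RHS]/evalat /evalxy meval_deg_le; last first.
    move=> m /(leading_le (leading_schur _ _ _)); rewrite sumn_partition_of_mnm.
    by have := ev_wdeg r; lia.
  by rewrite !mxE; apply: eq_bigr => t _; rewrite !mxE.
have MEunit : M *m E \in unitmx.
  rewrite -row_free_unit -kermx_eq0; apply/rowV0P => v /sub_kermxP vME.
  apply/rowP => s; rewrite [RHS]mxE; move: {2}(wdeg (ev s)) (leqnn (wdeg (ev s))) => k.
  elim/ltn_ind: k s => k IH s sk.
  (* In column [s], terms [r] of smaller weight vanish by induction, and the other [r != s] by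
     [evalat_schur_a_eq0]. *)
  have /rowP/(_ s) := vME; rewrite !mxE (bigD1 s) //= big1 ?addr0; last first.
    move=> r rs; rewrite ME; have [rk|kr] := ltnP (wdeg (ev r)) (wdeg (ev s)).
      by rewrite (IH _ (leq_trans rk sk)) ?mul0r.
    rewrite evalat_schur_a_eq0 ?mulr0 //; try exact: is_partition_of_mnm.
      by move/partition_of_mnm_inj/ev_inj => e; rewrite e eqxx in rs.
    by rewrite !sumn_partition_of_mnm.
  rewrite ME evalat_schur_a_diag //; last exact: is_partition_of_mnm.
  move/eqP; rewrite mulf_eq0 (negbTE (hookprod_neq0 a_inj _)) ?orbF => [/eqP //|].
  exact: is_partition_of_mnm.
have Eunit : E \in unitmx by move: MEunit; rewrite unitmx_mul => /andP[].
have c0 : \row_r F@_(ev r) = 0.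
  rewrite -[LHS](mulmxK Eunit) (_ : _ *m E = 0) ?mul0mx //.
  apply/rowP => s; rewrite mxE [RHS]mxE.
  transitivity (evalat a F (lam s)); last first.
    by rewrite F0 ?is_partition_of_mnm ?sumn_partition_of_mnm ?ev_wdeg.
  rewrite [RHS]/evalat /evalxy meval_deg_le //.
  by apply: eq_bigr => r _; rewrite !mxE.
apply/mpolyP => m; rewrite mcoeff0.
have [mF|mF] := boolP (m \in msupp F); last exact: memN_msupp_eq0.
have [r <-] := evP (hF m mF).
by have /rowP/(_ r) := c0; rewrite !mxE.
Qed.

End Uniqueness.

(** * Top homogeneous components *)

Section TopComponent.
Variable n : nat.
Implicit Types F G : {mpoly C[n]}.

Lemma mcoeff_topcomp F m :
  (topcomp F)@_m = if wdeg m == topdeg F then F@_m else 0.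
Proof.
rewrite /topcomp raddf_sum /= big_mkcond /=.
have [mF|mF] := boolP (m \in msupp F); last first.
  rewrite (memN_msupp_eq0 mF) if_same big1_seq // => m' /andP[_ m'F].
  case: ifP => // _; rewrite mcoeffZ mcoeffX.
  by case: eqP m'F mF => [->->|]; rewrite ?mulr0.
rewrite (bigD1_seq m) ?msupp_uniq //= big1 ?addr0 => [|m' m'm].
  by rewrite mcoeffZ mcoeffX eqxx mulr1.
by rewrite mcoeffZ mcoeffX (negbTE m'm) mulr0 if_same.
Qed.

Lemma wdeg_le_topdeg F m : m \in msupp F -> (wdeg m <= topdeg F)%N.
Proof. by move=> mF; apply: (@leq_bigmax_seq _ _ xpredT (@wdeg n)). Qed.

Lemma wsupp_eq0 (P : pred int) F m : wsupp P F -> ~~ P (wdeg m)%:Z -> F@_m = 0.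
Proof. by move=> hF Pm; apply: memN_msupp_eq0; apply: contra Pm; apply: hF. Qed.

(** A monomial [m0] of the nonzero [G] pins [topdeg F] to [d] in both directions. *)
Lemma topcomp_leading (d : nat) F G : G != 0 -> wsupp (pred1 d%:Z) G ->
  topcomp F = G <-> leading d F G.
Proof.
move=> G0 hG; have [m0 m0G] : exists m, m \in msupp G.
  by exists (mlead G); apply: mlead_supp.
have m0d : wdeg m0 = d by have /eqP[] := hG _ m0G.
split=> [FG|[_ hFG]].
  have td : topdeg F = d.
    move: m0G; rewrite -FG mcoeff_msupp mcoeff_topcomp m0d.
    by case: (d =P topdeg F) => // _; rewrite eqxx.
  split=> // m; rewrite mcoeff_msupp mcoeffB -FG mcoeff_topcomp td.
  case: (wdeg m =P d) => [_|md]; first by rewrite subrr eqxx.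
  by rewrite subr0 -mcoeff_msupp => /wdeg_le_topdeg; rewrite td; lia.
have FG m : wdeg m = d -> F@_m = G@_m.
  move=> md; apply/eqP; rewrite -subr_eq0 -mcoeffB; apply/eqP.
  by apply: wsupp_eq0 hFG _; rewrite md; lia.
have td : topdeg F = d.
  apply/eqP; rewrite eqn_leq; apply/andP; split; last first.
    by rewrite -{1}m0d wdeg_le_topdeg // mcoeff_msupp FG // -mcoeff_msupp.
  apply/bigmax_leqP_seq => m mF _.
  by have /(_ m mF) := leading_le (conj hG hFG); lia.
apply/mpolyP => m; rewrite mcoeff_topcomp td; case: eqP => [/FG //|md].
by rewrite (wsupp_eq0 hG) //=; apply/eqP => -[].
Qed.

End TopComponent.

(** * Nonvanishing of [schur] and the two characterizations *)

Lemma evalatB a n (F G : {mpoly C[n]}) l :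
  evalat a (F - G) l = evalat a F l - evalat a G l.
Proof. exact: raddfB. Qed.

Lemma deg_le_schur_a a n mu : deg_le (schur_a n a mu) (sumn mu).
Proof. by move=> m /(leading_le (leading_schur _ _ _)). Qed.

Lemma wsupp_lt_eq0 (a : int -> C) n (d : nat) (F : {mpoly C[n]}) :
  injective a -> (d <= n)%N ->
  wsupp (fun e => (e < d%:Z)%R) F ->
  (forall l, is_partition l -> (sumn l < d)%N -> evalat a F l = 0) -> F = 0.
Proof.
move=> a_inj; case: d => [|d] dn hF F0.
  by apply/mpolyP => m; rewrite mcoeff0; apply: wsupp_eq0 hF _; lia.
by apply: (deg_le_eq0 a_inj (ltnW dn)) => // m /hF; lia.
Qed.

(** If [schur n mu] were 0, [schur_a n a mu] would have degree below [sumn mu] and vanish at all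
    smaller diagrams, hence be 0, against its nonzero value at [mu]. *)
Lemma schur_neq0 (a : int -> C) n mu : injective a -> is_partition mu ->
  (sumn mu <= n)%N -> schur n mu != 0.
Proof.
move=> a_inj pmu mun; apply/eqP => S0; have [_] := leading_schur n a mu; rewrite S0 subr0 => hs.
have s0 : schur_a n a mu = 0.
  apply: (wsupp_lt_eq0 a_inj mun hs) => l pl lmu.
  by apply: evalat_schur_a_eq0 => // [e|]; [rewrite e ltnn in lmu | exact: ltnW].
have := hookprod_neq0 a_inj pmu.
by rewrite -(evalat_schur_a_diag a_inj pmu mun) s0 /evalat /evalxy meval0 eqxx.
Qed.

Theorem theorem13 (a : int -> C) (ha : injective a)
    (mu : seq nat) (hmu : is_partition mu)
    (n : nat) (hn : (sumn mu <= n)%N) (F : {mpoly C[n]}) :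
  (F = schur_a n a mu <->
     ((forall lam : seq nat, is_partition lam -> lam <> mu ->
         (sumn lam <= sumn mu)%N -> evalat a F lam = 0) /\
      (deg_le F (sumn mu) /\ evalat a F mu = hookprod a mu)))
  /\
  (F = schur_a n a mu <->
     ((forall lam : seq nat, is_partition lam ->
         (sumn lam < sumn mu)%N -> evalat a F lam = 0) /\
      topcomp F = schur n mu)).
Proof.
have vanish lam := @evalat_schur_a_eq0 a n mu ha hmu hn lam.
have vanish_lt lam : is_partition lam -> (sumn lam < sumn mu)%N ->
    evalat a (schur_a n a mu) lam = 0.
  move=> plam lt; apply: vanish => //; last exact: ltnW.
  by move=> e; rewrite e ltnn in lt.
have lead := leading_schur n a mu.
have topP G := topcomp_leading G (schur_neq0 ha hmu hn) lead.1.
split; split.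
- move=> ->; split; first exact: vanish.
  by split; [exact: deg_le_schur_a | exact: evalat_schur_a_diag].
- move=> [F0 [hF Fmu]]; apply/eqP; rewrite -subr_eq0; apply/eqP.
  apply: (deg_le_eq0 ha hn) => [m /msuppB_le|l pl lmu].
    by rewrite mem_cat => /orP[/hF|/deg_le_schur_a].
  rewrite evalatB; have [->|/eqP ne] := eqVneq l mu.
    by rewrite Fmu evalat_schur_a_diag // subrr.
  by rewrite F0 // vanish // subrr.
- by move=> ->; split; [exact: vanish_lt | apply/topP].
- move=> [F0 /topP leadF]; apply/eqP; rewrite -subr_eq0; apply/eqP.
  apply: (wsupp_lt_eq0 ha hn) => [|l pl lmu]; last by rewrite evalatB F0 // vanish_lt // subrr.
  (* The common top component cancels, so the difference has degree below [sumn mu]. *)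
  have -> : F - schur_a n a mu = (F - schur n mu) - (schur_a n a mu - schur n mu) by ring.
  by apply: wsuppB; [exact: leadF.2 | exact: lead.2].
Qed.
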